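(* Let $\mathcal F_n$ be the set of words in $\{1,2\}^*$ of length $n$ with no two consecutive ones, and let $\mathcal F_{n,k}$ be the set of $w\in\mathcal F_n$ with exactly $k$ ones. Let $f_n(q,t)=\sum_{w\in\mathcal F_n}q^{\operatorname{maj} w}t^{\operatorname{des} w}$. For $0\le k\le n$, $$\phi(\mathcal F_{n,k})=\{w\in\Pi(1^k2^{n-k}) : \lambda(w)=(\lambda_1,\ldots,\lambda_k)\text{ with }\lambda_1\le n-k\text{ and }\lambda_k\ge k-1\},$$ where $\phi$ is Foata's fundamental bijection. It follows that $$f_n(q,t)=\sum_{k\ge0}q^{k(k-1)}t^{k-1}\left(\genfrac{[}{]}{0pt}{}{n-k}{k-1}+q^kt\genfrac{[}{]}{0pt}{}{n-k}{k}\right).$$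
   Context: $\mathbb P^*$ is the set of all finite words in the positive integers. For $w=a_1\ldots a_n\in\mathbb P^*$: $\operatorname{Des} w=\{i: 1\le i<n,\ a_i>a_{i+1}\}$, $\operatorname{des} w=|\operatorname{Des} w|$, $\operatorname{maj} w=\sum_{i\in\operatorname{Des} w} i$. $\Pi(w)$ is the set of all rearrangements of $w$, and $a^m$ denotes $m$ copies of $a$. Foata's fundamental bijection $\phi:\mathbb P^*\to\mathbb P^*$: $\phi(\epsilon)=\epsilon$ for the empty word $\epsilon$. For $v=a_1\ldots a_n$ with $n\ge1$, define $w_1=a_1$ and, given $w_i=b_1\ldots b_i$, define $w_{i+1}$ as follows. If $b_i\le a_{i+1}$ (respectively $b_i>a_{i+1}$), factor $w_i=f_1f_2\cdots f_k$ uniquely so that in each factor every letter is $>a_{i+1}$ (respectively $\le a_{i+1}$) except its last letter, which is $\le a_{i+1}$ (respectively $>a_{i+1}$). Let $g_j$ be obtained from $f_j$ by moving its last letter to the front, and set $w_{i+1}=g_1g_2\cdots g_k\,a_{i+1}$. Then $\phi(v)=w_n$. The map $\phi$ is a bijection preserving the multiset of letters. Partition of a word: for $w\in\{1,2\}^*$ with $m$ ones and $n$ twos, view $w$ as a lattice path from $(0,0)$ to $(n,m)$, a $1$ being a unit north step and a $2$ a unit east step. $\lambda(w)$ is the integer partition whose Ferrers diagram consists of the boxes of the $m\times n$ rectangle ($m$ rows, $n$ columns) lying northwest of this path; $\lambda_i$ is the number of twos preceding the $i$th one of $w$ counted from the right. In the claim, $\lambda(w)$ for $w$ with $k$ ones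 is written with exactly $k$ entries $\lambda_1\ge\cdots\ge\lambda_k\ge0$ (zeros allowed); for $k=0$ the conditions on $\lambda$ are vacuous. $[n]=1+q+\cdots+q^{n-1}$, $[n]!=[1][2]\cdots[n]$, $\genfrac{[}{]}{0pt}{}{n}{k}=\frac{[n]!}{[k]!\,[n-k]!}$ for $0\le k\le n$, and $\genfrac{[}{]}{0pt}{}{n}{k}=0$ if $k<0$ or $k>n$. *)

(* Defs.v *)
From mathcomp Require Import all_boot all_order all_algebra.
From mathcomp Require Import boolp classical_sets cardinality fsbigop.

Set Implicit Arguments.
Unset Strict Implicit.
Unset Printing Implicit Defensive.

Import GRing.Theory.

(* Words are sequences of naturals: nothing below depends on the letters being
   positive, and the words of interest have letters 1 and 2. Positions in a
   word a_1 ... a_n are counted from 1, so that a_i is [nth 0 w i.-1]. *)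

Definition Des (w : seq nat) : seq nat :=
  [seq i <- iota 1 (size w).-1 | nth 0 w i < nth 0 w i.-1].

Definition des (w : seq nat) : nat := size (Des w).

Definition maj (w : seq nat) : nat := \sum_(i <- Des w) i.

(* [cut p w] cuts w after each letter satisfying p: when the last letter of w
   satisfies p, it is the unique factorisation of w into nonempty factors in
   which the last letter, and no other one, satisfies p (see [cutP] and
   [cut_uniq]). *)
Fixpoint cut (p : pred nat) (w : seq nat) : seq (seq nat) :=
  if w isn't x :: w' then [::] else
  if p x then [:: x] :: cut p w' else
  if cut p w' is f :: fs then (x :: f) :: fs else [:: [:: x]].

(* The step from w_i to w_{i+1}, with a = a_{i+1}; [rotr 1] moves the last
   letter of a factor to its front. *)
Definition foata_step (w : seq nat) (a : nat) : seq nat :=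
  let p := if last 0 w <= a then fun x => x <= a else fun x => a < x in
  rcons (flatten [seq rotr 1 f | f <- cut p w]) a.

(* The first step yields [foata_step [::] a_1 = [:: a_1]]. *)
Definition foata (v : seq nat) : seq nat := foldl foata_step [::] v.

(* [:: lambda_1; ...; lambda_k] where k is the number of ones of w *)
Definition lambda (w : seq nat) : seq nat :=
  rev [seq count_mem 2 (take i w) | i <- iota 0 (size w) & nth 0 w i == 1].

Definition Fib (n : nat) : set (seq nat) :=
  [set w | [/\ size w = n, all (mem [:: 1; 2]) w & ~~ infix [:: 1; 1] w]]%classic.

Definition Fibk (n k : nat) : set (seq nat) :=
  [set w | Fib n w /\ count_mem 1 w = k]%classic.

Definition Rearr (w : seq nat) : set (seq nat) :=
  [set w' | perm_eq w' w]%classic.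

Section QAnalogues.
Local Open Scope ring_scope.
Variables (K : fieldType) (q t : K).

Definition qint (n : nat) : K := \sum_(i < n) q ^+ i.

Definition qfact (n : nat) : K := \prod_(i < n) qint i.+1.

Definition qbinom (n k : int) : K :=
  if 0 <= k <= n then qfact (absz n) / (qfact (absz k) * qfact (absz (n - k))) else 0.

Definition fpoly (n : nat) : K := \sum_(w \in Fib n) q ^+ maj w * t ^+ des w.

End QAnalogues.

(* The generating functions live in Frac(Z[q][t]), with q and t the
   indeterminates: the summand for k = 0 involves t^-1, and the q-factorials
   in the denominators of the q-binomial coefficients are nonzero there. *)
Definition Qqt : fieldType := {fraction {poly {poly int}}}.
Definition qvar : Qqt := tofrac (('X : {poly int})%:P)%R.
Definition tvar : Qqt := tofrac ('X : {poly {poly int}})%R.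

(* A factor of the kind prescribed in Foata's construction *)
Definition is_factor (p : pred nat) (f : seq nat) : bool :=
  if f is x :: s then all (predC p) (belast x s) && p (last x s) else false.

Lemma cutP (p : pred nat) (w : seq nat) : w = [::] \/ p (last 0 w) ->
  flatten (cut p w) = w /\ all (is_factor p) (cut p w).
Proof.
elim: w => //= x w IH [//|]; case: w IH => [|y w] IH pl.
  by rewrite /= in pl *; rewrite pl /= pl.
have [E A] := IH (or_intror pl); case: ifP => px.
  by split; [rewrite /= E | rewrite /= px; exact: A].
case: (cut p (y :: w)) E A => [//|[//|z f] fs] /= -> /andP[/andP[A1 A2] A3].
by rewrite /= px A1 A2 A3.
Qed.

Lemma cut_uniq (p : pred nat) (fs : seq (seq nat)) :
  all (is_factor p) fs -> cut p (flatten fs) = fs.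
Proof.
elim: fs => //= f fs IH /andP[Hf /IH {}IH].
elim: f Hf => //= x s IHs; case: s IHs => [|y s] IHs /=.
  by move=> ->; rewrite IH.
case/andP=> /andP[/negbTE-> A] B.
by have /= -> := IHs (introT andP (conj A B)).
Qed.

Lemma size_lambda (w : seq nat) : size (lambda w) = count_mem 1 w.
Proof.
rewrite size_rev size_map size_filter -[in RHS](mkseq_nth 0 w) /mkseq count_map.
by apply: eq_count.
Qed.

(* Hence the sum defining [fpoly] is an honest finite sum. *)
Lemma finite_Fib (n : nat) : finite_set (Fib n).
Proof.
apply: (@sub_finite_set _ _
  [set` [seq map val (u : n.-tuple 'I_3) | u in predT]]%classic); last first.
  exact: finite_seq.
move=> w [sw /allP aw _] /=.
have lt3 x : x \in w -> x < 3 by move/aw; rewrite !inE => /orP[] /eqP->.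
have su : size (map (inord : nat -> 'I_3) w) == n by rewrite size_map sw.
apply/mapP; exists (Tuple su); first by rewrite mem_enum.
rewrite -map_comp -[LHS]map_id; apply/eq_in_map => x /lt3 xlt /=.
by rewrite inordK.
Qed.

(* Main.v *)
Require Import Defs.
From mathcomp Require Import all_boot all_order all_algebra.
From mathcomp Require Import boolp classical_sets cardinality fsbigop.
From mathcomp Require Import zify ring.

(** A word without consecutive ones is empty, is the letter 1, or ends in 2 or
in 21.  Removing the final 2, or the final 21, leaves an arbitrary word without
consecutive ones that is shorter by one or by two letters ([Fib_rec]), and both
claims follow from this decomposition by induction on the length.

Foata's map.  Appending 2, the largest letter, cuts the word into single
letters, so phi(v2) = phi(v)2.  Appending 1 to a word u2 cuts it into factors
1...12, and moving the final 2 of every factor to its front amounts to moving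
the final 2 of u2 to its front: 2u.  Hence phi(v21) = 2 phi(v) 1.  The other
step of the construction, appending 1 after a 1, never occurs, so the image is
generated from the words of length at most one by w -> w2 and w -> 2w1.
The condition lambda_k >= k-1 says that a word with k > 0 ones begins with at
least k-1 twos.  Neither operation changes its truth value: when w contains a 1,
the first affects neither side, and the second adds one initial two and one 1.
Moreover a word of length at least two that satisfies the condition and ends in
1 must begin with 2.  The set [Late] defined by the condition therefore obeys
the same recursion ([Late_rec]), and [image_foata_Fib] follows.  As phi permutes
the letters, the number of ones can be prescribed on both sides.

The generating function.  A final 2 creates no descent, and a final 21 creates
one descent, at position n-1 in a word of length n.  Hence
f_n = f_(n-1) + q^(n-1) t f_(n-2) ([fpoly_rec]).  The right-hand side satisfies
the same recursion summand by summand: if T(n,k) is the k-th summand, then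
T(n,k+1) = T(n-1,k+1) + q^(n-1) t T(n-2,k) ([fib_term_rec]), by the q-Pascal
rule applied to each of its two q-binomial coefficients. *)

Set Implicit Arguments.
Unset Strict Implicit.
Unset Printing Implicit Defensive.

Import GRing.Theory.

Local Open Scope classical_set_scope.

(** * Foata's map on words in two letters *)

Lemma perm_flatten_rotr (T : eqType) (m : nat) (fs : seq (seq T)) :
  perm_eq (flatten [seq rotr m f | f <- fs]) (flatten fs).
Proof. by elim: fs => //= f fs IH; apply: perm_cat; first rewrite perm_rotr. Qed.

Lemma perm_foata_step (w : seq nat) (a : nat) :
  perm_eq (foata_step w a) (rcons w a).
Proof.
rewrite /foata_step; set p := (X in cut X _).
have [E _] : flatten (cut p w) = w /\ all (is_factor p) (cut p w).
  by apply: cutP; right; rewrite /p; case: leqP.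
by rewrite -!cats1 perm_cat2r -[X in perm_eq _ X]E perm_flatten_rotr.
Qed.

Lemma foata_rcons (v : seq nat) (a : nat) :
  foata (rcons v a) = foata_step (foata v) a.
Proof. exact: foldl_rcons. Qed.

Lemma perm_foata (v : seq nat) : perm_eq (foata v) v.
Proof.
elim/last_ind: v => // v a IH; rewrite foata_rcons.
by apply: (perm_trans (perm_foata_step _ _)); rewrite -!cats1 perm_cat2r.
Qed.

Lemma flatten_cut_all (p : pred nat) (w : seq nat) :
  all p w -> flatten [seq rotr 1 f | f <- cut p w] = w.
Proof. by elim: w => //= x w IH /andP[-> /IH {2}<-]. Qed.

(** When every marked letter is c, moving the last letter of each factor to its
front turns u_1 c u_2 c ... u_r c into c u_1 c u_2 ... c u_r: since the moved
letters are all equal, this has the effect of moving one c from the end to the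
beginning of the whole word. *)
Lemma flatten_rotr_cut (p : pred nat) (u : seq nat) (c : nat) :
  p c -> {in u, forall x, p x -> x = c} ->
  flatten [seq rotr 1 f | f <- cut p (rcons u c)] = c :: u.
Proof.
move=> pc; elim: u => [|x u IH] uc /=; first by rewrite pc.
have {}IH := IH (fun y yu => uc y (@mem_behead _ (x :: u) y yu)).
case: ifP => px; first by rewrite /= IH (uc x (mem_head _ _) px).
(* x joins the first factor, which has to be nonempty for its last letter to
   be the c that moves to the front. *)
have [_] : flatten (cut p (rcons u c)) = rcons u c
           /\ all (is_factor p) (cut p (rcons u c)).
  by apply: cutP; right; rewrite last_rcons.
case: (cut p _) IH => // f fs.
case/lastP: f => [|f d] //=; rewrite -rcons_cons !rotr1_rcons /=.
by case=> -> ->.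
Qed.

(** A letter at least as large as all earlier ones marks each of them, so all
factors are single letters and nothing moves. *)
Lemma foata_step_max (w : seq nat) (a : nat) :
  all (leq^~ a) w -> foata_step w a = rcons w a.
Proof.
move=> wa; rewrite /foata_step ifT ?flatten_cut_all //.
by case/lastP: w wa => // w b; rewrite last_rcons all_rcons => /andP[].
Qed.

Notation word12 := (all (mem [:: 1; 2])).

Lemma foata_step21 (u : seq nat) :
  word12 u -> foata_step (rcons u 2) 1 = 2 :: rcons u 1.
Proof.
move=> /allP u12; rewrite /foata_step last_rcons /= flatten_rotr_cut //.
by move=> x /u12; rewrite !inE => /orP[] /eqP->.
Qed.

Lemma foata2 (v : seq nat) :
  word12 v -> foata (rcons v 2) = rcons (foata v) 2.
Proof.
move=> v12; rewrite foata_rcons foata_step_max // (perm_all _ (perm_foata v)).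
by apply: sub_all v12 => x; rewrite !inE => /orP[] /eqP->.
Qed.

Lemma foata21 (v : seq nat) :
  word12 v -> foata (rcons (rcons v 2) 1) = 2 :: rcons (foata v) 1.
Proof.
move=> v12; rewrite foata_rcons foata2 // foata_step21 //.
by rewrite (perm_all _ (perm_foata v)).
Qed.

(** * Decomposition of the words without consecutive ones *)

Lemma infix11_rcons (w : seq nat) (a : nat) :
  infix [:: 1; 1] (rcons w a)
  = (last 0 w == 1) && (a == 1) || infix [:: 1; 1] w.
Proof.
rewrite -[LHS]infix_rev rev_rcons -[in RHS]infix_rev infix_consl.
congr (_ || _); case/lastP: w => [|w b]; first by rewrite /= andbF.
by rewrite rev_rcons last_rcons /= prefix0s andbT andbC !(eq_sym 1).
Qed.

Lemma Fib0 : Fib 0 = [set [::]].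
Proof. by apply/seteqP; split=> [w [/size0nil-> _ _]|w ->]; split. Qed.

Lemma Fib1 : Fib 1 = [set [:: 1]; [:: 2]].
Proof.
apply/seteqP; split=> [[|x [|y w]] [//= _ + _]|w [->|->]] //.
by rewrite andbT !inE => /orP[] /eqP->; [left | right].
Qed.

Lemma Fib_rec (n : nat) :
  Fib n.+2 = (rcons^~ 2) @` Fib n.+1
             `|` (fun v => rcons (rcons v 2) 1) @` Fib n.
Proof.
apply/seteqP; split=> w.
  case/lastP: w => [[//]|w a] [].
  rewrite size_rcons all_rcons infix11_rcons => -[sw] /=; rewrite inE.
  case/andP=> /orP[/eqP->|]; last first.
    by rewrite inE => /eqP-> w12; rewrite andbF => w11; left; exists w.
  case/lastP: w sw => [//|w b]; rewrite size_rcons last_rcons => -[sw].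
  rewrite all_rcons /= inE => /andP[/orP[/eqP->//|]].
  rewrite inE infix11_rcons => /eqP-> w12; rewrite andbF /= => w11.
  by right; exists w.
case=> -[v [sv v12 v11] <-]; split; rewrite ?size_rcons ?sv //.
- by rewrite all_rcons.
- by rewrite infix11_rcons andbF.
- by rewrite !all_rcons.
- by rewrite !infix11_rcons last_rcons andbF.
Qed.

(** * The image of Foata's map *)

(** Over {1,2}, the number of letters before the first 1 is the number of initial
twos, and it equals lambda_k when there are k > 0 ones ([lambda_last]).  For a
word without ones the inequality holds trivially, as does the condition on lambda. *)
Definition Late (n : nat) : set (seq nat) :=
  [set w | [/\ size w = n, word12 w & count_mem 1 w <= (index 1 w).+1]].

Lemma Late0 : Late 0 = [set [::]].
Proof. by apply/seteqP; split=> [w [/size0nil-> _ _]|w ->]; split. Qed.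

Lemma Late1 : Late 1 = [set [:: 1]; [:: 2]].
Proof.
apply/seteqP; split=> [[|x [|y w]] [//= _ + _]|w [->|->]] //.
by rewrite andbT !inE => /orP[] /eqP->; [left | right].
Qed.

(** If w has no 1, the index of 1 is the length of w and the final 2 increases
it, but then the inequality holds for w and for w2. *)
Lemma late2 (w : seq nat) :
  (count_mem 1 (rcons w 2) <= (index 1 (rcons w 2)).+1)
  = (count_mem 1 w <= (index 1 w).+1).
Proof.
rewrite -cats1 count_cat addn0 index_cat; case: ifP => // /count_memPn->.
by rewrite !leq0n.
Qed.

(** Both sides increase by one; when w has no 1, the index of the new 1 is the
length of w, which is also the default value of the index of 1 in w. *)
Lemma late21 (w : seq nat) :
  (count_mem 1 (2 :: rcons w 1) <= (index 1 (2 :: rcons w 1)).+1)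
  = (count_mem 1 w <= (index 1 w).+1).
Proof.
rewrite /= -cats1 count_cat addn1 ltnS index_cat addn0.
by case: ifP => // /negbT; rewrite -index_mem -leqNgt => h; congr (_ <= _.+1);
  apply/eqP; rewrite eqn_leq index_size h.
Qed.

Lemma Late_rec (n : nat) :
  Late n.+2 = (rcons^~ 2) @` Late n.+1
              `|` (fun v => 2 :: rcons v 1) @` Late n.
Proof.
apply/seteqP; split=> w; last first.
  case=> -[v [sv v12 v11] <-]; split.
  - by rewrite size_rcons sv.
  - by rewrite all_rcons.
  - by rewrite late2.
  - by rewrite /= size_rcons sv.
  - by rewrite /= all_rcons.
  - by rewrite late21.
case/lastP: w => [[//]|w a] [].
rewrite size_rcons all_rcons /= inE => -[sw] /andP[/orP[/eqP->|]]; last first.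
  by rewrite inE => /eqP-> w12; rewrite late2 => lw; left; exists w.
case: w sw => [//|b w] /= [sw] /andP[/[!inE]/orP[/eqP->|/eqP-> w12 lw]].
  (* 1w1 has at least two ones, but no initial two. *)
  by rewrite -cats1 count_cat addn1.
by right; exists w => //; split=> //; rewrite -late21.
Qed.

Lemma image_foata_Fib (n : nat) : foata @` Fib n = Late n.
Proof.
elim/ltn_ind: n => -[|[|n]] IH.
- by rewrite Fib0 Late0 image_set1.
- by rewrite Fib1 Late1 image_setU !image_set1.
rewrite Fib_rec Late_rec image_setU !image_comp.
rewrite -(IH n.+1) // -(IH n) // !image_comp; congr (_ `|` _).
- by apply: eq_imagel => v [_ v12 _] /=; rewrite foata2.
- by apply: eq_imagel => v [_ v12 _] /=; rewrite foata21.
Qed.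

Lemma image_foata_Fibk (n k : nat) :
  foata @` Fibk n k = Late n `&` [set w | count_mem 1 w = k].
Proof.
rewrite -image_foata_Fib; apply/seteqP; split=> w.
  case=> v [vF vk] <-; split; first by exists v.
  by rewrite /= (permP (perm_foata v)).
case=> -[v vF <-] /= vk; exists v => //; split=> //.
by rewrite -vk (permP (perm_foata v)).
Qed.

Lemma perm_word12 (w : seq nat) : word12 w ->
  perm_eq w (nseq (count_mem 1 w) 1 ++ nseq (count_mem 2 w) 2).
Proof.
elim: w => //= x w IH /andP[+ /IH {}IH]; rewrite !inE => /orP[] /eqP->.
  by rewrite add1n add0n /= perm_cons.
by rewrite add1n add0n /= perm_sym -[2 :: nseq _ _]cat1s perm_catCA /= perm_cons perm_sym.
Qed.

Lemma size_word12 (w : seq nat) :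
  word12 w -> size w = count_mem 1 w + count_mem 2 w.
Proof.
by move=> w12; rewrite {1}(perm_size (perm_word12 w12)) size_cat !size_nseq.
Qed.

Lemma RearrE (n k : nat) (w : seq nat) : k <= n ->
  Rearr (nseq k 1 ++ nseq (n - k) 2) w
  <-> [/\ size w = n, word12 w & count_mem 1 w = k].
Proof.
move=> kn; split=> [wkn|[sw w12 wk]]; last first.
  by rewrite /Rearr /= -{1}wk -sw -wk size_word12 // addKn perm_word12.
split.
- by rewrite (perm_size wkn) size_cat !size_nseq subnKC.
- by rewrite (perm_all _ wkn) all_cat !all_nseq !orbT.
- by rewrite (permP wkn) count_cat !count_nseq mul1n mul0n addn0.
Qed.

(** * The partition of a word *)

Lemma lambda_le (w : seq nat) (x : nat) : x \in lambda w -> x <= count_mem 2 w.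
Proof.
rewrite mem_rev => /mapP[i _ ->].
by rewrite -{2}(cat_take_drop i w) count_cat leq_addr.
Qed.

(** The smallest part counts the twos to the left of the first 1, and nothing but
twos stands there. *)
Lemma lambda_last (w : seq nat) : word12 w -> 1 \in w ->
  nth 0 (lambda w) (count_mem 1 w).-1 = index 1 w.
Proof.
move=> w12 w1; rewrite -size_lambda nth_last /lambda.
set L := [seq _ | _ <- _]; suff [s ->] : exists s, L = index 1 w :: s.
  by rewrite rev_cons last_rcons.
have ltiw : index 1 w < size w by rewrite index_mem.
have -> : index 1 w = count_mem 2 (take (index 1 w) w).
  have /size_word12 : word12 (take (index 1 w) w).
    by move: w12; rewrite -{1}(cat_take_drop (index 1 w) w) all_cat => /andP[].
  have /count_memPn-> : 1 \notin take (index 1 w) w by rewrite in_take // ltnn.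
  by rewrite size_takel ?index_size.
rewrite /L -(subnKC ltiw) addSnnS iotaD filter_cat add0n.
rewrite [in X in X ++ _](@eq_in_filter _ _ pred0) ?filter_pred0; last first.
  by move=> j; rewrite mem_iota => /(before_find 0).
rewrite /= nth_index // eqxx /=.
by eexists.
Qed.

(** * The recursion for the generating function *)

(** For the empty word the default last letter 0 never exceeds a. *)
Lemma Des_rcons (w : seq nat) (a : nat) :
  Des (rcons w a) = Des w ++ if a < last 0 w then [:: size w] else [::].
Proof.
case: w => [|x w]; rewrite /Des //.
have -> : (size (rcons (x :: w) a)).-1 = size w + 1 by rewrite size_rcons addn1.
rewrite iotaD filter_cat; congr (_ ++ _).
  apply: eq_in_filter => i; rewrite mem_iota => /andP[i0 iw].
  by rewrite !nth_rcons /= !ifT //; lia.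
by rewrite add1n /= -rcons_cons !nth_rcons /= ltnn eqxx ltnSn -last_nth.
Qed.

Local Open Scope ring_scope.

Section GeneratingFunction.
Variables (K : fieldType) (q t : K).

Lemma weight2 (v : seq nat) : word12 v ->
  q ^+ maj (rcons v 2) * t ^+ des (rcons v 2) = q ^+ maj v * t ^+ des v.
Proof.
move=> v12; rewrite /maj /des Des_rcons ifF ?cats0 //.
case/lastP: v v12 => // v b; rewrite last_rcons all_rcons /= !inE.
by case/andP=> /orP[] /eqP->.
Qed.

Lemma weight21 (v : seq nat) : word12 v ->
  q ^+ maj (rcons (rcons v 2) 1) * t ^+ des (rcons (rcons v 2) 1)
  = q ^+ (size v).+1 * t * (q ^+ maj v * t ^+ des v).
Proof.
move=> v12; rewrite /maj /des Des_rcons last_rcons size_rcons /=.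
rewrite big_cat big_seq1 size_cat addn1 -/(maj _) -/(des _).
by rewrite exprD [t ^+ _.+1]exprSr mulrACA weight2 // mulrC.
Qed.

Lemma fpoly0 : fpoly q t 0 = 1.
Proof. by rewrite /fpoly Fib0 fsbig_set1 /maj /des big_nil mulr1. Qed.

Lemma fpoly1 : fpoly q t 1 = 1 + 1.
Proof.
rewrite /fpoly Fib1 fsbigU0 ?fsbig_set1; [|exact: finite_set1..|].
  by rewrite /maj /des !big_nil !mulr1.
by move=> w [-> ].
Qed.

Lemma fpoly_rec (n : nat) :
  fpoly q t n.+2 = fpoly q t n.+1 + q ^+ n.+1 * t * fpoly q t n.
Proof.
rewrite /fpoly Fib_rec fsbigU0; last 3 first.
- exact/finite_image/finite_Fib.
- exact/finite_image/finite_Fib.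
- by move=> w [[u _ <-] [v _ /(congr1 (last 0%N))]]; rewrite !last_rcons.
congr (_ + _).
  rewrite fsbig_image; last by move=> u v _ _ /rcons_inj[].
  by apply: eq_fsbigr => v /[!inE] -[_ v12 _]; rewrite weight2.
rewrite fsbig_image; last by move=> u v _ _ /rcons_inj[] /rcons_inj[].
rewrite mulr_fsumr; apply: eq_fsbigr => v /[!inE] -[sv v12 _].
by rewrite weight21 // sv.
Qed.

(** * The q-binomial sum *)

Lemma qintD (m n : nat) : qint q (m + n) = qint q m + q ^+ m * qint q n.
Proof.
rewrite /qint big_split_ord mulr_sumr; congr (_ + _).
by apply: eq_bigr => i _; rewrite exprD.
Qed.

Lemma qfactS (n : nat) : qfact q n.+1 = qfact q n * qint q n.+1.
Proof. exact: big_ord_recr. Qed.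

Lemma qbinom_nat (n k : nat) :
  qbinom q n k
  = if (k <= n)%N then qfact q n / (qfact q k * qfact q (n - k)) else 0.
Proof.
by rewrite /qbinom /= lez_nat; case: ifP => // kn; rewrite subzn.
Qed.

Lemma qbinom_small (n k : int) : n < k -> qbinom q n k = 0.
Proof. by move=> nk; rewrite /qbinom ifF //; lia. Qed.

Lemma qbinom_neg (n k : int) : k < 0 -> qbinom q n k = 0.
Proof. by move=> k0; rewrite /qbinom ifF //; lia. Qed.

Definition fib_term (n k : nat) : K :=
  q ^+ (k * (k - 1))%N * t ^ (k%:Z - 1) *
    (qbinom q (n%:Z - k%:Z) (k%:Z - 1)
     + q ^+ k * t * qbinom q (n%:Z - k%:Z) k%:Z).

(* These hold when q and t are indeterminates; the q-binomial coefficients are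
   quotients, and the summand for k = 0 involves t^-1. *)
Hypothesis qintS_neq0 : forall i, qint q i.+1 != 0.
Hypothesis t_neq0 : t != 0.

Lemma qfact_neq0 (n : nat) : qfact q n != 0.
Proof. by apply/prodf_neq0 => i _. Qed.

Lemma qbinom0 (n : nat) : qbinom q n 0 = 1.
Proof.
by rewrite (qbinom_nat n 0) subn0 /qfact big_ord0 mul1r divff // qfact_neq0.
Qed.

Lemma qbinomnn (n : nat) : qbinom q n n = 1.
Proof.
by rewrite qbinom_nat leqnn subnn /qfact big_ord0 mulr1 divff // qfact_neq0.
Qed.

Lemma qbinom_pascal (n k : nat) :
  qbinom q n.+1 k.+1 = qbinom q n k.+1 + q ^+ (n - k) * qbinom q n k.
Proof.
have [kn|nk|->] := ltngtP k n; last 2 first.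
- by rewrite !qbinom_small ?mulr0 ?addr0 //; lia.
- by rewrite !qbinomnn qbinom_small ?subnn ?mulr1 ?add0r //; lia.
rewrite -(subnKC kn); set m := (n - k.+1)%N; rewrite !qbinom_nat !ifT; try lia.
have -> : ((k.+1 + m).+1 - k.+1 = m.+1)%N by lia.
have -> : (k.+1 + m - k.+1 = m)%N by lia.
have -> : (k.+1 + m - k = m.+1)%N by lia.
have Eq : qint q (k.+1 + m).+1 = qint q m.+1 + q ^+ m.+1 * qint q k.+1.
  by rewrite -qintD; congr qint; lia.
rewrite !qfactS Eq.
have := qintS_neq0 k; have := qintS_neq0 m.
have := qfact_neq0 k; have := qfact_neq0 m.
set x := qint q m.+1; set y := qint q k.+1; set z := q ^+ m.+1.
move=> ? ? ? ?; field.
by repeat (apply/andP; split).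
Qed.

(** Multiplying by q^k removes the truncated difference n - k from the exponent:
for n < k, where q^k and q^(n - k) do not multiply to q^n, the last coefficient
is zero. *)
Lemma qbinom_pascalM (n k : nat) :
  q ^+ k * qbinom q n.+1 k.+1 = q ^+ k * qbinom q n k.+1 + q ^+ n * qbinom q n k.
Proof.
rewrite qbinom_pascal mulrDr; congr (_ + _).
have [kn|nk] := leqP k n; first by rewrite mulrA -exprD subnKC.
by rewrite (@qbinom_small n) ?mulr0.
Qed.

Lemma fib_termn0 (n : nat) : fib_term n 0 = 1.
Proof.
rewrite /fib_term subr0 sub0r qbinom_neg // qbinom0.
by rewrite !expr0 !mul1r add0r mulr1 exprN1 mulVf.
Qed.

Lemma fib_termS (n k : nat) :
  fib_term n k.+1 = q ^+ (k.+1 * k)%N * t ^+ k *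
    (qbinom q (n%:Z - k.+1%:Z) k + q ^+ k.+1 * t * qbinom q (n%:Z - k.+1%:Z) k.+1).
Proof. by rewrite /fib_term subn1 intS addrC addKr. Qed.

Lemma fib_term_small (n k : nat) : (n < k)%N -> fib_term n k = 0.
Proof.
case: k => // k nk; rewrite fib_termS !qbinom_small; try lia.
by rewrite mulr0 addr0 mulr0.
Qed.

(** Put m = n-k-1 and consider the index k+2 on the left.  Its two coefficients,
m+1 over k+1 and m+1 over k+2, split by the q-Pascal rule into four terms: those
with m over k+1 and m over k+2 that come without a power of q form the summand
for (n+1, k+2), and the other two, with m over k and m over k+1, form the summand
for (n, k+1) times q^(n+1) t.  At the index 1 the same happens with
fib_term n 0 = 1, whose first coefficient is zero.  For k >= n all three summands
vanish. *)
Lemma fib_term_rec (n k : nat) :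
  fib_term n.+2 k.+1 = fib_term n.+1 k.+1 + q ^+ n.+1 * t * fib_term n k.
Proof.
case: k => [|k].
  rewrite fib_termn0 !fib_termS !subzSS !subr0 !qbinom0 qbinom_pascal qbinom0.
  by rewrite subn0 muln0 !expr0 (exprS q n); ring.
have [kn|nk] := ltnP k n; last first.
  rewrite (@fib_term_small n) // (@fib_term_small n.+1) // mulr0 addr0.
  rewrite fib_termS !subzSS; have [->|?] := eqVneq k n.
    by rewrite !qbinom_small ?mulr0 ?addr0 ?mulr0 //; lia.
  by rewrite !qbinom_small ?mulr0 ?addr0 ?mulr0 //; lia.
set m := (n - k.+1)%N; rewrite !fib_termS.
have -> : n.+2%:Z - k.+2%:Z = m.+1%:Z by lia.
have -> : n.+1%:Z - k.+2%:Z = m%:Z by lia.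
have -> : n%:Z - k.+1%:Z = m%:Z by lia.
have -> : n.+1 = (k + m + 2)%N by lia.
have E1 := qbinom_pascalM m k; have E2 := qbinom_pascalM m k.+1.
(* Each q-binomial coefficient takes its factor q^k or q^(k+1) from the
   monomial in front, as the multiplied q-Pascal rule requires. *)
transitivity (q ^+ (k * k + k + k + 2) * t ^+ k.+1 *
    (q ^+ k * qbinom q m.+1 k.+1
     + q ^+ k.+1 * t * (q ^+ k.+1 * qbinom q m.+1 k.+2))).
  have -> : (k.+2 * k.+1 = k * k + k + k + 2 + k)%N by lia.
  by rewrite !(exprD, exprS); ring.
rewrite E1 E2.
have -> : (k.+2 * k.+1 = k * k + k + k + 2 + k)%N by lia.
have -> : (k.+1 * k = k * k + k)%N by lia.
by rewrite !(exprD, exprS); ring.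
Qed.

Lemma sum_fib_term (n N : nat) : (n < N)%N ->
  \sum_(k \in [set: nat]) fib_term n k = \sum_(k < N) fib_term n k.
Proof.
move=> nN; rewrite fsbig_ord; apply/esym/fsbig_widen => // k [_ /negP kN].
by apply: fib_term_small; lia.
Qed.

Lemma sum_fib_term_rec (n : nat) :
  \sum_(k \in [set: nat]) fib_term n.+2 k
  = \sum_(k \in [set: nat]) fib_term n.+1 k
    + q ^+ n.+1 * t * \sum_(k \in [set: nat]) fib_term n k.
Proof.
rewrite (sum_fib_term (ltnSn n.+2)) (sum_fib_term (leqnSn n.+2)).
rewrite (sum_fib_term (leqnSn n.+1)) big_ord_recl [in RHS]big_ord_recl.
rewrite !fib_termn0 -addrA mulr_sumr -big_split.
by congr (_ + _); apply: eq_bigr => k _; rewrite /= fib_term_rec.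
Qed.

Lemma fpolyE (n : nat) :
  fpoly q t n = \sum_(k \in [set: nat]) fib_term n k.
Proof.
elim/ltn_ind: n => -[|[|n]] IH.
- by rewrite fpoly0 (@sum_fib_term 0 1) // big_ord1 fib_termn0.
- rewrite fpoly1 (@sum_fib_term 1 2) // big_ord_recl big_ord1 fib_termn0.
  rewrite fib_termS subrr qbinom0 qbinom_small //.
  by rewrite mulr0 addr0 !mulr1.
by rewrite fpoly_rec sum_fib_term_rec !IH.
Qed.

End GeneratingFunction.

(** * Indeterminates, and the theorem *)

(** The polynomial 1 + X + ... + X^i has constant term 1. *)
Lemma qint_qvar_neq0 (i : nat) : qint qvar i.+1 != 0.
Proof.
have -> : qint qvar i.+1 = tofrac (\sum_(j < i.+1) 'X^j : {poly int})%:P.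
  rewrite !rmorph_sum; apply: eq_bigr => j _.
  by rewrite /qvar rmorphXn /= rmorphXn.
rewrite tofrac_eq0 polyC_eq0; apply: contraTneq (oner_neq0 int) => E.
have := congr1 (fun p : {poly int} => p.[0]) E.
rewrite big_ord_recl hornerD hornerE horner_sum big1; last first.
  by move=> j _; rewrite hornerXn expr0n.
by rewrite addr0 horner0 => ->; rewrite eqxx.
Qed.

Lemma tvar_neq0 : tvar != 0.
Proof. by rewrite tofrac_eq0 polyX_eq0. Qed.

Theorem theorem4p1 (n : nat) :
  (forall k : nat, (k <= n)%N ->
     foata @` Fibk n k =
     [set w | Rearr (nseq k 1%N ++ nseq (n - k)%N 2%N) w /\
              ((0 < k)%N ->
                 (nth 0%N (lambda w) 0 <= n - k)%N /\
                 (k - 1 <= nth 0%N (lambda w) k.-1)%N)])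
  /\
  fpoly qvar tvar n =
    \sum_(k \in [set: nat])
      qvar ^+ (k * (k - 1))%N * tvar ^ (k%:Z - 1) *
      (qbinom qvar (n%:Z - k%:Z) (k%:Z - 1)
       + qvar ^+ k * tvar * qbinom qvar (n%:Z - k%:Z) k%:Z).
Proof.
split; last exact: fpolyE qint_qvar_neq0 tvar_neq0 n.
move=> k kn; rewrite image_foata_Fibk; apply/seteqP; split=> w.
  case=> -[sw w12 lw] /= wk; split; first exact/RearrE.
  move=> k0; have w1 : 1%N \in w by rewrite -has_pred1 has_count wk.
  split; last by rewrite -wk lambda_last // leq_subLR.
  have -> : (n - k = count_mem 2 w)%N by rewrite -wk -sw size_word12 // addKn.
  by apply/lambda_le/mem_nth; rewrite size_lambda wk.
case=> /(RearrE _ kn)[sw w12 wk] kw; split=> //; split=> //.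
have [->//|k0] := posnP (count_mem 1%N w).
have [_] := kw (leq_trans k0 (eq_leq wk)).
by rewrite -wk lambda_last -?has_pred1 ?has_count // leq_subLR.
Qed.
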